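(* Let $\mathfrak{Q}\in(0,1]$, let $\mathcal{F}:\mathbb{R}^n\to\mathbb{R}^n$ be continuous with $\mathcal{F}(0)=0$, and consider the impulse-free conformable fractional-order system ${}_{t_0}\mathfrak{T}^{\mathfrak{Q}}_t\,\mathcal{S}(t)=\mathcal{F}(\mathcal{S}(t))$ for $t\ge t_0$, with $\mathcal{S}(t_0)=\mathcal{S}_0\in\mathbb{R}^n$ and $t_0=0$. Let $\mathcal{V}:\mathbb{R}^n\to[0,\infty)$ be a positive-definite function and write $\mathcal{V}(t)=\mathcal{V}(\mathcal{S}(t))$. Assume that, along the state trajectory of the system, $${}_{t_0}\mathfrak{T}^{\mathfrak{Q}}_t\,\mathcal{V}(t)\le -c\,\mathcal{V}^{\eta}(t),\qquad t\ge t_0,$$ where $c>0$ and $\eta\in(0,1)$ are constants. Then the system achieves finite-time stability. Moreover, with $\alpha=\frac{c(1-\eta)}{\mathfrak{Q}}>0$ and $\Gamma_{\mathcal{S}_0}=t_0+\left(\frac{\mathcal{V}^{1-\eta}(t_0)}{\alpha}\right)^{1/\mathfrak{Q}}$, $$\mathcal{V}^{1-\eta}(t)\le \mathcal{V}^{1-\eta}(t_0)-\alpha(t-t_0)^{\mathfrak{Q}},\qquad t_0\le t\le \Gamma_{\mathcal{S}_0},$$ and $$\mathcal{V}(t)\equiv 0,\qquad \forall t\ge\Gamma_{\mathcal{S}_0}.$$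
   Context: Conformable derivative: for $\mathfrak{Q}\in(0,1]$, the $\mathfrak{Q}$-order conformable fractional-order derivative starting from $t_0$ of a function $\mathfrak{H}$ is ${}_{t_0}\mathfrak{T}^{\mathfrak{Q}}_t\mathfrak{H}(t)=\lim_{\varepsilon\to0}\frac{\mathfrak{H}(t+\varepsilon(t-t_0)^{1-\mathfrak{Q}})-\mathfrak{H}(t)}{\varepsilon}$ for $t>t_0$, and its value at $t=t_0$ is the limit of this quantity as $t\to t_0^+$; $\mathfrak{H}$ is $\mathfrak{Q}$-differentiable if these limits exist. Positive-definite function: a continuous $\mathcal{V}:\mathbb{R}^n\to[0,\infty)$ with $\mathcal{V}(0)=0$ and $\mathcal{V}(\mathcal{S})>0$ for $\mathcal{S}\ne0$. Finite-time stability: the system achieves finite-time stability if there is a scalar $T_0>0$ (the settling time) such that $\lim_{t\to T_0}\mathcal{S}(t)=0$ and $\mathcal{S}(t)\equiv0$ for all $t\ge T_0$.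
   Formalization: The state trajectory is additionally assumed continuous on [t_0, ∞), in particular at t_0; the conformable derivative at t_0 does not involve S(t_0), and if S may jump just after t_0 the stated bound can fail. *)

(* Defs.v *)
From HB Require Import structures.
From mathcomp Require Import all_boot all_order all_algebra.
From mathcomp Require Import all_classical all_reals all_analysis.
Set Implicit Arguments.
Unset Strict Implicit.
Unset Printing Implicit Defensive.
Import Order.TTheory GRing.Theory Num.Theory.
Import numFieldNormedType.Exports.
Local Open Scope classical_set_scope.
Local Open Scope ring_scope.

Section Conformable.
Variables (R : realType) (E : normedModType R).
Implicit Types (Q t : R) (H : R -> E).

Definition conformable_quotient (t0 : R) Q H t (eps : R) : E :=
  eps^-1 *: (H (t + eps * (t - t0) `^ (1 - Q)) - H t).

(* Meaningful for [t0 < t] only: at [t = t0] and [Q < 1] the increment of the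
   argument vanishes, which is why [t0] is treated separately below. *)
Definition conformable_derive_gt (t0 : R) Q H t : E :=
  lim (conformable_quotient t0 Q H t eps @[eps --> 0^']).

Definition conformable_differentiable_gt (t0 : R) Q H t : Prop :=
  cvg (conformable_quotient t0 Q H t eps @[eps --> 0^']).

Definition conformable_derive (t0 : R) Q H t : E :=
  if t == t0 then lim (conformable_derive_gt t0 Q H x @[x --> t0^'+])
  else conformable_derive_gt t0 Q H t.

(* [lim] is a junk value when the limit does not exist, so differentiability at
   [t0] also asks for the derivatives just after [t0] to exist. *)
Definition conformable_differentiable (t0 : R) Q H t : Prop :=
  if t == t0 then
    (\forall x \near t0^'+, conformable_differentiable_gt t0 Q H x) /\
    cvg (conformable_derive_gt t0 Q H x @[x --> t0^'+])
  else conformable_differentiable_gt t0 Q H t.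

End Conformable.

Section System.
Variables (R : realType) (n : nat).
Implicit Types (F : 'rV[R]_n -> 'rV[R]_n) (S : R -> 'rV[R]_n).

(* Continuity is a separate clause because the conformable derivative at [t0] is
   a limit of derivatives at later times, which does not involve [S t0]. *)
Definition trajectory (t0 Q : R) F (S0 : 'rV[R]_n) S : Prop :=
  [/\ {within `[t0, +oo[, continuous S},
      S t0 = S0,
      forall t, t0 <= t -> conformable_differentiable t0 Q S t
    & forall t, t0 <= t -> conformable_derive t0 Q S t = F (S t)].

Definition positive_definite (V : 'rV[R]_n -> R) : Prop :=
  [/\ continuous V, forall x, 0 <= V x, V 0 = 0
    & forall x, x != 0 -> 0 < V x].

Definition finite_time_stable S : Prop :=
  exists T0 : R, [/\ 0 < T0, S t @[t --> T0^'] --> (0 : 'rV[R]_n)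
                   & forall t, T0 <= t -> S t = 0].

End System.

(* Main.v *)
Require Import Defs.
From HB Require Import structures.
From mathcomp Require Import all_boot all_order all_algebra.
From mathcomp Require Import all_classical all_reals all_analysis.
Set Implicit Arguments.
Unset Strict Implicit.
Unset Printing Implicit Defensive.
Import Order.TTheory GRing.Theory Num.Theory.
Import numFieldNormedType.Exports.
Local Open Scope classical_set_scope.
Local Open Scope ring_scope.

(** For [t > t0] the conformable derivative is the directional derivative of an
    ordinary function along the positive vector [(t - t0) `^ (1 - Q)], so the
    decay assumption on [w := V \o S] reads
    [w' t <= - c * w t `^ eta * (t - t0) `^ (Q - 1)]
    ([is_derive_conformable]). This is a separable differential inequality: as
    long as [w > 0], the function
    [g t := w t `^ (1 - eta) + alpha * (t - t0) `^ Q] has derivative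
    [(1 - eta) * w `^ (- eta) * w' + alpha * Q * (t - t0) `^ (Q - 1) <= 0],
    since [alpha * Q = c * (1 - eta)].

    Moreover [w] is nonincreasing, so [0 < w T] forces [w > 0] on the whole
    interval from [t0] to [T] and yields [g T <= g t0]
    ([conformable_decay_pos]). Everything else is a consequence. At [T >= Gamma] the term [alpha * (T - t0) `^ Q] is
    already as large as [g t0 = w t0 `^ (1 - eta)], so [w T] cannot be positive
    and vanishes. At [T <= Gamma] with [w T = 0] the bound says that its
    right-hand side is nonnegative, which is how [Gamma] is chosen. Finally
    [V] vanishes only at the origin, so [S] is [0] from [Gamma] on; any time
    after [Gamma] is then a settling time. *)

(** Substituting [h = k * eps] in the difference quotient trades the direction
    [k *: v] for [v]. *)
Lemma is_derive_unscale (R : realType) (V W : normedModType R) (f : V -> W)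
    (a v : V) (k : R) (df : W) :
  k != 0 -> is_derive a (k *: v) f df -> is_derive a v f (k^-1 *: df).
Proof.
move=> k0 [cvf fE].
have cv : h^-1 *: ((f \o shift a) (h *: v) - f a) @[h --> 0^'] --> k^-1 *: df.
  have -> : (fun h => h^-1 *: ((f \o shift a) (h *: v) - f a)) =
      (fun h => k^-1 *: ((h / k)^-1 *:
        ((f \o shift a) ((h / k) *: (k *: v)) - f a))).
    apply/funext => h; rewrite !scalerA divfK//; congr (_ *: _).
    by rewrite invfM invrK mulrCA mulVf ?mulr1.
  apply: cvgZ; first exact: cvg_cst.
  rewrite -fE.
  apply: (@cvg_comp _ _ _ ( *%R^~ k^-1)
    (fun h => h^-1 *: ((f \o shift a) (h *: (k *: v)) - f a)) _ (0 : R)^');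
    last exact: cvf.
  move=> A [e /= e0 eA]; exists (e * `|k|); first by rewrite /= mulr_gt0 ?normr_gt0.
  move=> h /= hek h0; apply: eA => /=; last by rewrite mulf_neq0 ?invr_neq0.
  by move: hek; rewrite !sub0r !normrN normrM normfV ltr_pdivrMr ?normr_gt0.
split; first exact: cvgP cv.
exact: cvg_lim cv.
Qed.

(** The conformable quotient is literally the difference quotient defining the
    derivative of [H] along [(t - t0) `^ (1 - Q)], which is nonzero off [t0]. *)
Lemma is_derive_conformable (R : realType) (E : normedModType R)
    (t0 Q : R) (H : R -> E) (t : R) :
  t0 < t -> conformable_differentiable_gt t0 Q H t ->
  is_derive t 1 H ((t - t0) `^ (Q - 1) *: conformable_derive_gt t0 Q H t).
Proof.
move=> t0t dH.
have tt0 : 0 < t - t0 by rewrite subr_gt0.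
have k0 : (t - t0) `^ (1 - Q) != 0 by rewrite gt_eqF// powR_gt0.
have qE : conformable_quotient t0 Q H t = (fun h => h^-1 *:
    ((H \o shift t) (h *: ((t - t0) `^ (1 - Q) *: (1 : R))) - H t)).
  by apply/funext => h; rewrite /conformable_quotient /= [_ + t]addrC /GRing.scale /= mulr1.
rewrite -[Q - 1]opprB powRN; apply: is_derive_unscale k0 _.
by split; move: dH; rewrite /conformable_differentiable_gt /conformable_derive_gt qE.
Qed.

Lemma derivable_continuous_at (R : realType) (f : R -> R) (x : R) :
  derivable f x 1 -> f y @[y --> x] --> f x.
Proof. by move=> /derivable1_diffP/differentiable_continuous. Qed.

Lemma is_derive1_powR_comp (R : realType) (f : R -> R) (x df p : R) :
  0 < f x -> is_derive x 1 f df ->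
  is_derive x 1 (fun y => f y `^ p) (p * f x `^ (p - 1) * df).
Proof.
move=> fx0 fdf.
exact: (@is_derive1_comp R (@powR R ^~ p) f _ _ _ (is_derive1_powR p fx0)).
Qed.

Section conformable_decay.
Context {R : realType} (t0 Q c eta : R) (w : R -> R^o).
Hypotheses (Q_gt0 : 0 < Q) (c_gt0 : 0 < c) (eta_lt1 : eta < 1).
Hypothesis w_cont : {within `[t0, +oo[, continuous w}.
Hypothesis w_diff : forall t, t0 < t -> conformable_differentiable_gt t0 Q w t.
Hypothesis w_decay : forall t, t0 < t ->
  conformable_derive_gt t0 Q w t <= - c * w t `^ eta.

Let alpha := c * (1 - eta) / Q.

Let w_deriv t : t0 < t ->
  is_derive t 1 w ((t - t0) `^ (Q - 1) * conformable_derive_gt t0 Q w t).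
Proof. by move=> t0t; exact: is_derive_conformable t0t (w_diff t0t). Qed.

Lemma conformable_decay_nincr t u : t0 <= t -> t <= u -> w u <= w t.
Proof.
apply: (@ler0_derive1_nincry _ w t0) => //.
  by move=> x; rewrite in_itv/= andbT => /w_deriv.
move=> x; rewrite in_itv/= andbT => t0x.
have ? := w_deriv t0x; rewrite derive1E derive_val mulr_ge0_le0 ?powR_ge0//.
by rewrite (le_trans (w_decay t0x))// mulNr oppr_le0 mulr_ge0 ?powR_ge0// ltW.
Qed.

(** The integrated form of the separable inequality. Positivity of [w] at the
    final time alone suffices, because [w] is nonincreasing; it keeps
    [w `^ (1 - eta)] differentiable up to [T]. *)
Lemma conformable_decay_pos T : t0 <= T -> 0 < w T ->
  w T `^ (1 - eta) + alpha * (T - t0) `^ Q <= w t0 `^ (1 - eta).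
Proof.
move=> t0T wT.
have w_gt0 t : t0 <= t -> t <= T -> 0 < w t.
  by move=> t0t tT; rewrite (lt_le_trans wT)// conformable_decay_nincr.
pose g t := w t `^ (1 - eta) + alpha * (t - t0) `^ Q.
have g_deriv t : t0 < t -> t <= T -> is_derive t 1 g
    ((1 - eta) * w t `^ (1 - eta - 1) *
       ((t - t0) `^ (Q - 1) * conformable_derive_gt t0 Q w t) +
     alpha * (Q * (t - t0) `^ (Q - 1) * 1)).
  move=> t0t tT.
  have dw := is_derive1_powR_comp (1 - eta) (w_gt0 _ (ltW t0t) tT) (w_deriv t0t).
  have ds : is_derive t 1 (fun s => s - t0) 1.
    by apply: is_derive_eq; rewrite subr0.
  have dq : is_derive t 1 (fun s => (s - t0) `^ Q) (Q * (t - t0) `^ (Q - 1) * 1).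
    by apply: is_derive1_powR_comp ds; rewrite subr_gt0.
  exact: is_deriveD.
suff: g T <= g t0 by rewrite /g subrr powR0 ?gt_eqF// mulr0 addr0.
have [->//|Tt0] := eqVneq T t0.
have t0ltT : t0 < T by rewrite lt_neqAle eq_sym Tt0.
apply: (@ler0_derive1_le_cc _ g t0 T); rewrite ?in_itv/= ?lexx ?t0T//.
- by move=> t; rewrite in_itv/= => /andP[t0t /ltW tT]; have := g_deriv _ t0t tT.
- move=> t; rewrite in_itv/= => /andP[t0t /ltW tT].
  have ? := g_deriv _ t0t tT; rewrite derive1E derive_val.
  have wt := w_gt0 _ (ltW t0t) tT.
  (* Factor out (t - t0) `^ (Q - 1) and 1 - eta; what remains is
     w `^ (- eta) times the conformable derivative, plus c, nonpositive by the decay assumption. *)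
  have -> : 1 - eta - 1 = - eta by rewrite addrAC subrr add0r.
  have aQ : alpha * Q = c * (1 - eta) by rewrite /alpha divfK// gt_eqF.
  rewrite mulr1 mulrA aQ mulrCA.
  rewrite (mulrC _ ((t - t0) `^ _)) -mulrDr mulr_ge0_le0 ?powR_ge0//.
  rewrite [c * _]mulrC -mulrA -mulrDr mulr_ge0_le0 ?subr_ge0 ?(ltW eta_lt1)//.
  rewrite -[leRHS](subrr c) addrC lerD2l powRN ler_pdivrMl ?powR_gt0//.
  by rewrite mulrC w_decay.
- apply/continuous_within_itvP => //; split.
  + move=> t; rewrite in_itv/= => /andP[t0t /ltW tT].
    apply: derivable_continuous_at.
    by have := g_deriv _ t0t tT.
  (* For Q < 1 the power (s - t0) `^ Q is not differentiable at t0, so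
     continuity there comes from the one-sided limit. *)
  + have /continuous_within_itvcyP[_ w_t0] := w_cont.
    apply: cvgD.
      apply: (@cvg_comp _ _ _ w (@powR R ^~ (1 - eta)) _ _ _ w_t0).
      apply: derivable_continuous_at.
      by have := is_derive1_powR (1 - eta) (w_gt0 _ (lexx _) t0T).
    rewrite subrr powR0 ?gt_eqF// mulr0 -[X in _ --> X](mulr0 alpha).
    apply: cvgM; first exact: cvg_cst.
    apply: (@cvg_comp _ _ _ (fun s => s - t0) (@powR R ^~ Q)
      _ _ _ _ (powR_cvg0 Q_gt0)).
    move=> A [e /= e0 eA]; exists e => //= s st0 t0s.
    by apply: eA; rewrite /= ?subr_gt0// sub0r opprB.
  + apply: cvg_at_left_filter.
    apply: derivable_continuous_at.
    by have := g_deriv _ t0ltT (lexx _).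
Qed.

End conformable_decay.

Theorem lemma2 (R : realType) (n : nat) (Q t0 c eta : R)
    (F : 'rV[R]_n -> 'rV[R]_n) (S0 : 'rV[R]_n) (S : R -> 'rV[R]_n)
    (V : 'rV[R]_n -> R)
    (Q_gt0 : 0 < Q) (Q_le1 : Q <= 1) (t0_eq0 : t0 = 0)
    (F_cont : continuous F) (F0 : F 0 = 0)
    (S_traj : trajectory t0 Q F S0 S)
    (V_pd : positive_definite V)
    (c_gt0 : 0 < c) (eta_gt0 : 0 < eta) (eta_lt1 : eta < 1)
    (VS_diff : forall t, t0 <= t ->
       conformable_differentiable t0 Q (fun s => V (S s) : R^o) t)
    (VS_decay : forall t, t0 <= t ->
       conformable_derive t0 Q (fun s => V (S s) : R^o) t <= - c * V (S t) `^ eta) :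
  let alpha := c * (1 - eta) / Q in
  let Gamma := t0 + (V (S t0) `^ (1 - eta) / alpha) `^ Q^-1 in
  [/\ finite_time_stable S,
      0 < alpha,
      forall t, t0 <= t <= Gamma ->
        V (S t) `^ (1 - eta) <= V (S t0) `^ (1 - eta) - alpha * (t - t0) `^ Q
    & forall t, Gamma <= t -> V (S t) = 0].
Proof.
move=> alpha Gamma.
have [S_cont _ _ _] := S_traj.
have [V_cont V_ge0 V0 V_gt0] := V_pd.
have alpha_gt0 : 0 < alpha by rewrite divr_gt0// mulr_gt0// subr_gt0.
have VS_cont : {within `[t0, +oo[, continuous (fun s => V (S s) : R^o)}.
  apply: (@within_continuous_comp _ _ _ _ S V) => // x _; exact: V_cont.
have VS_diff_gt t : t0 < t ->
    conformable_differentiable_gt t0 Q (fun s => V (S s) : R^o) t.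
  move=> t0t; have := VS_diff _ (ltW t0t).
  by rewrite /conformable_differentiable gt_eqF.
have VS_decay_gt t : t0 < t ->
    conformable_derive_gt t0 Q (fun s => V (S s) : R^o) t <= - c * V (S t) `^ eta.
  move=> t0t; have := VS_decay _ (ltW t0t).
  by rewrite /conformable_derive gt_eqF.
have bound := conformable_decay_pos Q_gt0 c_gt0 eta_lt1 VS_cont
  VS_diff_gt VS_decay_gt.
have t0Gamma : t0 <= Gamma by rewrite lerDl powR_ge0.
have Gamma_pow : alpha * (Gamma - t0) `^ Q = V (S t0) `^ (1 - eta).
  rewrite /Gamma addrAC subrr add0r -powRrM mulVf ?gt_eqF// powRr1.
    by rewrite mulrC divfK// gt_eqF.
  by rewrite divr_ge0 ?powR_ge0// ltW.
have VS_eq0 t : Gamma <= t -> V (S t) = 0.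
  move=> Gt; apply/eqP; case: eqP => // /eqP VSt0.
  have VSt : 0 < V (S t) by rewrite lt_neqAle eq_sym VSt0 V_ge0.
  have := bound _ (le_trans t0Gamma Gt) VSt.
  rewrite leNgt => /negP[]; apply: ltr_pwDl; first by rewrite powR_gt0.
  rewrite -Gamma_pow ler_pM2l// ge0_ler_powR ?nnegrE ?subr_ge0 ?lerD2r//.
  - exact: ltW.
  - exact: le_trans Gt.
have S_eq0 t : Gamma <= t -> S t = 0.
  by move=> /VS_eq0 VSt; apply/eqP; apply: contraT => /V_gt0; rewrite VSt ltxx.
split=> //.
(* Gamma itself can fail to be a settling time: when S t0 = 0 it equals t0,
   which is not positive, and S is unconstrained before t0. *)
- exists (Gamma + 1); split.
  + by rewrite ltr_wpDl// -t0_eq0.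
  + apply: cvg_near_cst; apply: nbhs_dnbhs.
    near=> t; apply: S_eq0; apply: ltW; near: t.
    by apply: lt_nbhsr; rewrite ltrDl.
  + by move=> t Gt; apply: S_eq0; rewrite (le_trans _ Gt)// lerDl.
- move=> t /andP[t0t tG]; rewrite lerBrDr.
  have [VSt|VSt] := eqVneq (V (S t)) 0; last first.
    by apply: bound => //; rewrite lt_neqAle eq_sym VSt V_ge0.
  rewrite VSt powR0 ?subr_eq0 ?gt_eqF// add0r -Gamma_pow ler_pM2l//.
  by rewrite ge0_ler_powR ?nnegrE ?subr_ge0 ?lerD2r// ltW.
Unshelve. all: by end_near. Qed.
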